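(* Let $\mathrm{El}_2$ be the coarse moduli space (over $\mathbb{C}$, defined up to birational isomorphism) of pairs $(C,L)$ consisting of an elliptic curve $C$ and a line bundle $L$ of degree $2$ on $C$, identified with the GIT-quotient $\mathbb{P}(\mathbb{C}[X,Y]_4)/\!/\mathrm{SL}(2)\cong\mathbb{P}^1$ of the space of binary quartic forms. Then the degree of the self-map $\mathrm{El}_2\to \mathrm{El}_2$ defined by the Hessian covariant of binary quartics, i.e. the map sending the class of a binary quartic $F$ to the class of its Hessian $\mathrm{He}(F)$, is equal to $2$.
   Context: The ground field is $\mathbb{C}$. Moduli problem: to a scheme $S$ one assigns the set of flat proper morphisms $p\colon X\to S$ of relative dimension 1 together with an invertible sheaf $\mathcal{L}$ on $X$ such that $p$ is smooth over an open dense subset of $S$ with elliptic curves as fibres, and the restriction $\mathcal{L}_s$ of $\mathcal{L}$ to each fibre $X_s$ is an invertible sheaf of degree $2$. Two families $(X\to S,\mathcal{L})$, $(X'\to S,\mathcal{L}')$ are equivalent if there are an open dense $V\subset S$ and an isomorphism of $V$-schemes $X_V\to X'_V$ under which the restrictions of the sheaves correspond. The coarse moduli space is a scheme, unique up to birational isomorphism, receiving a universal morphism of functors from this moduli functor to its functor of points in the category of schemes with rational maps as morphisms, and bijective on $\mathbb{C}$-points. It is birationally isomorphic to the GIT-quotient $\mathbb{P}(\mathbb{C}[X,Y]_4)/\!/\mathrm{SL}(2)$: a pair $(C,L)$ corresponds to the binary quartic whose zeros are the branch points of the double cover $C\to\mathbb{P}^1$ given by $L$. Here $\mathbb{C}[X,Y]_4$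 is the space of homogeneous polynomials of degree $4$, $\mathbb{P}(\cdot)$ is the space of nonzero polynomials up to scaling, and the GIT-quotient is $\mathrm{Proj}\,\mathbb{C}[\mathsf{I}_2,\mathsf{I}_3]\cong\mathbb{P}^1$, where $\mathsf{I}_2,\mathsf{I}_3$ are the basic invariants of degrees $2$ and $3$, which freely generate the algebra of $\mathrm{SL}(2)$-invariant polynomial functions on $\mathbb{C}[X,Y]_4$. The Hessian $\mathrm{He}(F)$ of $F\in\mathbb{C}[X,Y]_4$ is the determinant of the $2\times 2$ matrix of second partial derivatives of $F$; it is again a binary quartic form, and $F\mapsto\mathrm{He}(F)$ is $\mathrm{SL}(2)$-equivariant, so it induces a rational self-map of the GIT-quotient. The degree of a dominant rational map between varieties of the same dimension is the degree of the corresponding extension of function fields. *)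

(* Defs.v *)
From HB Require Import structures.
From mathcomp Require Import all_boot all_order all_algebra.
From mathcomp Require Import fraction boolp reals.
From mathcomp.real_closed Require Import complex.
From mathcomp.multinomials Require Import mpoly.

Set Implicit Arguments.
Unset Strict Implicit.
Unset Printing Implicit Defensive.

Import GRing.Theory.

Local Open Scope ring_scope.

Section Quartics.
Variable A : comNzRingType.
Implicit Types F : {mpoly A[2]}.

(* The monomial X^(4-i) Y^i, where X = 'X_0 and Y = 'X_1. *)
Definition quartic_mnm (i : 'I_5) : 'X_{1..2} :=
  [multinom (if (j == 0 :> nat) then 4 - i else i)%N | j < 2].

Definition quartic_coord F (i : 'I_5) : A := F@_(quartic_mnm i).

Definition hessian F : {mpoly A[2]} :=
  \det (\matrix_(i < 2, j < 2) F^`M(i)^`M(j)).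

(* The linear substitution (X, Y) |-> (X, Y) *m g. *)
Definition linear_subst (g : 'M[A]_2) F : {mpoly A[2]} :=
  F \mPo [tuple \sum_(j < 2) g j i *: 'X_j | i < 2].

(* Polynomial functions on the space of binary quartics are elements of
   {mpoly A[5]}, the variable 'X_i standing for the coefficient of
   X^(4-i) Y^i. *)
Definition eval_quartic (f : {mpoly A[5]}) F : A := f.@[quartic_coord F].

Definition sl2_invariant (f : {mpoly A[5]}) : Prop :=
  forall (g : 'M[A]_2) F, \det g = 1 -> F \is 4.-homog ->
    eval_quartic f (linear_subst g F) = eval_quartic f F.

End Quartics.

Section HessianPullback.
Variable A : comNzRingType.

Definition generic_quartic : {mpoly {mpoly A[5]}[2]} :=
  \sum_(i < 5) 'X_i *: 'X_[quartic_mnm i].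

(* The polynomial function F |-> f (He F), see hessian_pullbackE below. *)
Definition hessian_pullback (f : {mpoly A[5]}) : {mpoly A[5]} :=
  f \mPo [tuple quartic_coord (hessian generic_quartic) i | i < 5].

Lemma mdeg_quartic_mnm i : mdeg (quartic_mnm i) = 4.
Proof.
rewrite mdegE big_ord_recl big_ord1 !mnmE /= subnK //.
by rewrite -ltnS ltn_ord.
Qed.

Lemma quartic_mnm_inj : injective quartic_mnm.
Proof. by move=> i j /mnmP /(_ ord_max); rewrite !mnmE /= => /ord_inj. Qed.

Lemma quartic_mnmP (m : 'X_{1..2}) :
  reflect (exists i, m = quartic_mnm i) (mdeg m == 4).
Proof.
apply: (iffP eqP) => [dm|[i ->]]; last exact: mdeg_quartic_mnm.
have dm2 : (m ord0 + m ord_max = 4)%N.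
  by rewrite -[RHS]dm mdegE big_ord_recl big_ord1; congr (_ + m _)%N;
    apply: val_inj.
have lt5 : (m ord_max < 5)%N by rewrite ltnS -dm2 leq_addl.
exists (Ordinal lt5); apply/mnmP => j; rewrite mnmE /=.
case: j => [[|[|//]] lj] /=.
  by rewrite -dm2 addnK; congr (m _); apply: val_inj.
by congr (m _); apply: val_inj.
Qed.

Lemma mderiv_homog (B : comNzRingType) d (F : {mpoly B[2]}) i :
  F \is d.+1.-homog -> F^`M(i) \is d.-homog.
Proof.
move=> hF; apply/dhomogP => m; rewrite mcoeff_msupp mcoeff_deriv => nz.
have : (m + U_(i))%MM \in msupp F.
  rewrite mcoeff_msupp; apply: contraNneq nz => ->.
  by rewrite mul0rn.
by move/(dhomogP _ _ _ hF); rewrite /= mdegD mdeg1 addn1 => -[].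
Qed.

Lemma hessian_homog (B : comNzRingType) (F : {mpoly B[2]}) :
  F \is 4.-homog -> hessian F \is 4.-homog.
Proof.
move=> hF; rewrite /hessian (expand_det_row _ ord0); apply: rpred_sum => j _.
rewrite /cofactor det_mx11 !mxE mulrCA rpredMsign.
by apply: (@dhomogM _ _ _ 2 _ 2); do 2!apply: mderiv_homog.
Qed.

Lemma generic_quarticE (F : {mpoly A[2]}) : F \is 4.-homog ->
  map_mpoly (meval (quartic_coord F)) generic_quartic = F.
Proof.
move=> hF; apply/mpolyP => m; rewrite mcoeff_map_mpoly /= /generic_quartic.
rewrite raddf_sum raddf_sum /=.
under eq_bigr => i _ do rewrite mcoeffZ mcoeffX mevalM mevalXU rmorph_nat.
have [/quartic_mnmP [j ->]|dm] := boolP (mdeg m == 4).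
  rewrite (bigD1 j) //= eqxx mulr1 big1 ?addr0 // => i ne.
  by rewrite (inj_eq quartic_mnm_inj) (negPf ne) mulr0.
rewrite (dhomog_nemf_coeff hF dm) big1 // => i _.
rewrite [_ == m](_ : _ = false) ?mulr0 //; apply: contraNF dm => /eqP <-.
by rewrite mdeg_quartic_mnm.
Qed.

Lemma map_mpoly_mderiv (B B' : comNzRingType) (h : {rmorphism B -> B'}) n
  (p : {mpoly B[n]}) i : map_mpoly h p^`M(i) = (map_mpoly h p)^`M(i).
Proof.
by apply/mpolyP => m; rewrite !(mcoeff_map_mpoly, mcoeff_deriv) /= raddfMn.
Qed.

Lemma hessian_map (B B' : comNzRingType) (h : {rmorphism B -> B'})
  (F : {mpoly B[2]}) : map_mpoly h (hessian F) = hessian (map_mpoly h F).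
Proof.
by rewrite /hessian -det_map_mx; congr (\det _); apply/matrixP => i j;
  rewrite !mxE /= !map_mpoly_mderiv.
Qed.

Lemma hessian_pullbackE (f : {mpoly A[5]}) (F : {mpoly A[2]}) :
  F \is 4.-homog ->
  eval_quartic (hessian_pullback f) F = eval_quartic f (hessian F).
Proof.
move=> hF; rewrite /eval_quartic comp_mpoly_meval; apply: meval_eq => i.
rewrite tnth_mktuple -[in RHS](generic_quarticE hF) -hessian_map.
by rewrite /quartic_coord mcoeff_map_mpoly.
Qed.

End HessianPullback.

Section Subfield.
Variables (F : fieldType) (S : divringClosed F).

Record subfield := Subfield { subfield_val : F; _ : subfield_val \in S }.

HB.instance Definition _ := [isSub for subfield_val].
HB.instance Definition _ := [Choice of subfield by <:].
HB.instance Definition _ := [SubChoice_isSubIntegralDomain of subfield by <:].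
HB.instance Definition _ := [SubIntegralDomain_isSubField of subfield by <:].

End Subfield.

Section FunctionField.
Variable C : fieldType.
Implicit Types (f g : {mpoly C[5]}) (x y : {fraction {mpoly C[5]}}).

(* x = f / g with f and g homogeneous SL(2)-invariants of the same degree. *)
Definition El2_fraction x f g : Prop :=
  [/\ exists d, f \is d.-homog /\ g \is d.-homog,
      sl2_invariant f, sl2_invariant g, g != 0 &
      x = FracField.tofrac f / FracField.tofrac g].

(* The function field of the GIT quotient Proj C[V]^SL(2), V the space of
   binary quartics: the degree 0 part of the homogeneous localization of the
   graded algebra of invariants.  As El_2 is defined up to birational
   isomorphism and is identified with this quotient, a pair (C, L) corresponding
   to the class of the quartic vanishing at the branch points of the double
   cover C -> P^1 given by L, this is also the function field of El_2. *)
Definition El2_rational : {pred {fraction {mpoly C[5]}}} :=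
  fun x => `[< exists f g, El2_fraction x f g >].

Lemma El2_divring_closed : divring_closed El2_rational.
Proof.
have inv1 : sl2_invariant (1 : {mpoly C[5]}).
  by move=> g F _ _; rewrite /eval_quartic !meval1.
have invM f g : sl2_invariant f -> sl2_invariant g -> sl2_invariant (f * g).
  move=> If Ig h F dh hF; rewrite /eval_quartic !mevalM.
  by congr (_ * _); [exact: If|exact: Ig].
have invB f g : sl2_invariant f -> sl2_invariant g -> sl2_invariant (f - g).
  move=> If Ig h F dh hF; rewrite /eval_quartic !mevalB.
  by congr (_ - _); [exact: If|exact: Ig].
have hom1 : (1 : {mpoly C[5]}) \is 0.-homog by exact: dhomog1.
split.
- apply/asboolP; exists 1, 1; split=> //; first by exists 0%N.
    exact: oner_neq0.
  by rewrite rmorph1 divr1.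
- move=> x y /asboolP [f [g [[d [hf hg]] If Ig g0 ->]]].
  move=> /asboolP [f' [g' [[d' [hf' hg']] If' Ig' g'0 ->]]].
  apply/asboolP; exists (f * g' - f' * g), (g * g'); split.
  + exists (d + d')%N; split; last exact: dhomogM.
    by apply: rpredB; last rewrite addnC; exact: dhomogM.
  + by apply: invB; exact: invM.
  + exact: invM.
  + exact: mulf_neq0.
  + by rewrite -mulNr addf_div ?tofrac_eq0 // mulNr rmorphB !rmorphM.
- move=> x y /asboolP [f [g [[d [hf hg]] If Ig g0 ->]]].
  move=> /asboolP [f' [g' [[d' [hf' hg']] If' Ig' g'0 ->]]].
  have [->|f'0] := eqVneq f' 0.
    rewrite rmorph0 mul0r invr0 mulr0; apply/asboolP; exists 0, 1; split=> //.
    + by exists 0%N; split=> //; exact: rpred0.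
    + by move=> h F _ _; rewrite /eval_quartic !meval0.
    + exact: oner_neq0.
    + by rewrite rmorph0 mul0r.
  apply/asboolP; exists (f * g'), (g * f'); split.
  + by exists (d + d')%N; split; exact: dhomogM.
  + exact: invM.
  + exact: invM.
  + exact: mulf_neq0.
  + by rewrite invf_div mulf_div !rmorphM.
Qed.

HB.instance Definition _ :=
  GRing.isDivringClosed.Build {fraction {mpoly C[5]}} El2_rational
    El2_divring_closed.

Definition El2_field : fieldType := subfield El2_rational.

(* phi is the comorphism (f / g) |-> (f o He) / (g o He) of the rational
   self-map [F] |-> [He F].  That it is defined on the whole function field,
   i.e. that g o He does not vanish identically when g does not, says that the
   self-map is dominant. *)
Definition hessian_comorphism (phi : {rmorphism El2_field -> El2_field}) :
    Prop :=
  forall (x : El2_field) f g, El2_fraction (subfield_val x) f g ->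
    hessian_pullback g != 0 /\
    subfield_val (phi x) = FracField.tofrac (hessian_pullback f) /
                      FracField.tofrac (hessian_pullback g).

End FunctionField.

(* The field extension phi : K -> L has degree n: L has a basis with n elements
   over phi(K).  For the comorphism phi of a dominant rational map, n is the
   degree of the map. *)
Definition extension_degree (K L : fieldType) (phi : {rmorphism K -> L})
    (n : nat) : Prop :=
  exists b : 'I_n -> L, forall y : L,
    exists! c : {ffun 'I_n -> K}, y = \sum_(i < n) phi (c i) * b i.

(* Main.v *)
From HB Require Import structures.
Require Import Defs.
From mathcomp Require Import all_boot all_order all_algebra.
From mathcomp Require Import reals boolp fraction.
From mathcomp.real_closed Require Import complex.
From mathcomp.multinomials Require Import mpoly.
From mathcomp Require Import ring.

(** A binary quartic with distinct roots can be moved by SL(2) to the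
    Weierstrass shape Y (X^3 + a X Y^2 + b Y^3): send one root to infinity, then
    translate and rescale.  On these quartics the classical invariants I2 and
    I3 are -3 a and -27 b, so the section a, b |-> Y (X^3 + a X Y^2 + b Y^3) can
    be parametrized by I2 and I3, and every invariant f satisfies
    f = f (section (I2, I3)) off the discriminant 4 I2^3 - I3^2, hence
    identically ([invariant_weierstrass_tuple]).  This single identity gives
    everything needed about invariants: if f has degree d, rescaling the
    quartic by l multiplies f by l^d and (I2, I3) by (l^2, l^3); taking
    l = 2 I2 / I3 turns (I2, I3) into (j, 2 j) with j = 4 I2^3 / I3^2.  So a
    ratio of invariants of equal degree is a rational function of j
    ([El2_gen]), and the function field is C(j), where j is transcendental
    because it is not a constant and C is algebraically closed.

    The Hessian acts on the invariants by
      I2 (He F) = 144 I2^2   and   I3 (He F) = 1728 (I3^2 - 2 I2^3),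
    so it sends j to (j / (j - 2))^2 ([El2_hessian_j]).  The square root
    t = j / (j - 2) is another coordinate of the line, as j = 2 t / (t - 1).
    Thus the image of the comorphism is C(t^2), over which C(t) has the basis
    1, t: the degree is 2 ([extension_degree_moebius_square]).  That the Hessian
    of a general quartic is general, which makes the comorphism well defined,
    follows from the same formulas: the two equations above can be solved for
    I2 and I3 of F, whatever the invariants of He F ([hessian_pullback_eq0]). *)

Set Implicit Arguments.
Unset Strict Implicit.
Unset Printing Implicit Defensive.

Import GRing.Theory Num.Theory.
Local Open Scope ring_scope.

(** * Self-maps of the line given by the square of a coordinate *)

(** A polynomial over an algebraically closed field splits, so one of its
    linear factors vanishes at t, which makes t a constant. *)
Lemma closed_transcendental (C : closedFieldType) (L : fieldType)
    (iota : {rmorphism C -> L}) (t : L) :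
  (forall c, t != iota c) -> forall p, (map_poly iota p).[t] = 0 -> p = 0.
Proof.
move=> nt p; have [r ->] := closed_field_poly_normal p.
rewrite map_polyZ hornerZ rmorph_prod horner_prod => /eqP.
rewrite mulf_eq0 prodf_seq_eq0 => /orP[|/hasP [z _]].
  by rewrite fmorph_eq0 => /eqP ->; rewrite scale0r.
by rewrite /= rmorphB /= map_polyX map_polyC hornerXsubC subr_eq0
  (negPf (nt z)).
Qed.

(** The two sides have no monomial in common: compare odd coefficients. *)
Lemma even_mulX_eq_even (R : nzRingType) (p q : {poly R}) :
  (p \Po 'X^2) * 'X = q \Po 'X^2 -> p = 0.
Proof.
move=> eq_pq; apply/polyP => i.
have := congr1 (fun r : {poly R} => r`_i.*2.+1) eq_pq.
rewrite coefMX !coef_comp_poly_Xn //= dvdn2 dvdn2 /= odd_double /=.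
by rewrite -muln2 mulnK // coef0.
Qed.

(** Spanning is the second hypothesis; independence of 1 and t over the image
    of phi is the first, since a nontrivial relation would express t. *)
Lemma extension_degree_sqrt (K L : fieldType) (phi : {rmorphism K -> L})
    (t : L) :
  (forall a, t != phi a) -> (forall y, exists a b, y = phi a + phi b * t) ->
  extension_degree phi 2.
Proof.
move=> nt gen; exists (fun i : 'I_2 => t ^+ i) => y.
have [a [b ->]] := gen y.
exists [ffun i : 'I_2 => if i == ord0 then a else b]; split.
  by rewrite !big_ord_recl big_ord0 !ffunE /= expr0 mulr1 addr0.
move=> c; rewrite !big_ord_recl big_ord0 expr0 mulr1 addr0 expr1.
set j := lift _ _ => eq_ab.
have eq_b : b = c j.
  apply/eqP; rewrite -subr_eq0; apply: contraT => nz.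
  have /eqP[] := nt ((c ord0 - a) / (b - c j)).
  rewrite fmorph_div !rmorphB /=.
  have nz' : phi b - phi (c j) != 0 by rewrite -rmorphB fmorph_eq0.
  apply: (mulIf nz'); rewrite mulfVK // mulrBr !(mulrC t).
  apply/eqP; rewrite subr_eq addrAC -eq_ab; apply/eqP; ring.
apply/ffunP => i; rewrite ffunE; case: eqVneq => [->|ni].
  by move: eq_ab; rewrite eq_b => /addIr /fmorph_inj.
by rewrite eq_b; congr (c _); apply: val_inj; case: i ni => [[|[|]]].
Qed.

(** In this section L = C(s) is purely transcendental over the constants, and
    phi is the comorphism of the self-map s |-> (s / (s - 2))^2 of the line. *)
Section SquareOfMoebius.
Variables (C : closedFieldType) (L : fieldType) (iota : {rmorphism C -> L}).
Variables (phi : {rmorphism L -> L}) (s : L).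
Hypothesis two_neq0 : 2 != 0 :> L.
Hypothesis phi_iota : forall c, phi (iota c) = iota c.
Hypothesis s_notin : forall c, s != iota c.
Hypothesis s_gen : forall y, exists p q : {poly C},
  (map_poly iota q).[s] != 0 /\
  y = (map_poly iota p).[s] / (map_poly iota q).[s].
Hypothesis phi_s : phi s = (s / (s - 2)) ^+ 2.

Let t := s / (s - 2).

Let s2_neq0 : s - 2 != 0.
Proof. by rewrite subr_eq0; have := s_notin 2; rewrite rmorph_nat. Qed.

Let s_t : s = 2 * t / (t - 1).
Proof.
rewrite /t; field; rewrite s2_neq0 /=.
by rewrite mulN1r subKr.
Qed.

Let t_notin c : t != iota c.
Proof.
apply: contra_neq (s_notin (2 * c / (c - 1))) => tc.
by rewrite s_t tc fmorph_div rmorphM rmorphB rmorph_nat rmorph1.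
Qed.

Let phi_horner (p : {poly C}) :
  phi (map_poly iota p).[s] = (map_poly iota (p \Po 'X^2)).[t].
Proof.
rewrite -horner_map /= phi_s -map_poly_comp map_comp_poly map_polyXn.
rewrite horner_comp hornerXn; congr _.[_]; apply: eq_map_poly => c.
exact: phi_iota.
Qed.

(** An element of the image is p(t^2) / q(t^2); it equals t only if
    t q(t^2) = p(t^2), which is impossible by parity. *)
Let t_notin_phi a : t != phi a.
Proof.
apply/negP => /eqP; have [p [q [q0 ->]]] := s_gen a.
rewrite fmorph_div /= => eq_t.
have eq_pq : (map_poly iota (p \Po 'X^2)).[t] =
             t * (map_poly iota (q \Po 'X^2)).[t].
  by rewrite -!phi_horner {1}eq_t divfK ?fmorph_eq0.
suff q_eq0 : q = 0 by rewrite q_eq0 rmorph0 horner0 eqxx in q0.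
apply: (@even_mulX_eq_even _ q p); apply/eqP; rewrite -subr_eq0; apply/eqP.
apply: (closed_transcendental t_notin).
rewrite rmorphB rmorphM /= map_polyX hornerD hornerN hornerM hornerX.
by rewrite eq_pq; ring.
Qed.

(** The span of 1 and t over the image of phi is a subring because t^2 is
    phi s, and a field because the norm a^2 - b^2 s of a + b t is nonzero.  As
    it contains the constants and s, it is all of L. *)
Let spanned y := exists a b, y = phi a + phi b * t.

Let spannedD x y : spanned x -> spanned y -> spanned (x + y).
Proof.
move=> [a [b ->]] [c [d ->]]; exists (a + c), (b + d).
by rewrite !rmorphD /=; ring.
Qed.

Let spannedM x y : spanned x -> spanned y -> spanned (x * y).
Proof.
move=> [a [b ->]] [c [d ->]]; exists (a * c + b * d * s), (a * d + b * c).
by rewrite !(rmorphD, rmorphM) /= phi_s -/t; ring.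
Qed.

Let spannedV x : spanned x -> spanned x^-1.
Proof.
move=> [a [b ->]]; pose n := a ^+ 2 - b ^+ 2 * s.
have phi_n : phi n = (phi a - phi b * t) * (phi a + phi b * t).
  by rewrite /n !(rmorphD, rmorphN, rmorphM, rmorphXn) /= phi_s -/t; ring.
have [b0|b0] := eqVneq b 0.
  by exists a^-1, 0; rewrite b0 rmorph0 !mul0r !addr0 fmorphV.
have pb0 : phi b != 0 by rewrite fmorph_eq0.
have n1 : phi a - phi b * t != 0.
  rewrite subr_eq0; apply: contra_neq (t_notin_phi (a / b)) => eq_ab.
  by rewrite fmorph_div eq_ab mulrAC mulfV // mul1r.
have n2 : phi a + phi b * t != 0.
  rewrite addr_eq0; apply: contra_neq (t_notin_phi (- (a / b))) => eq_ab.
  by rewrite rmorphN fmorph_div eq_ab mulNr opprK mulrAC mulfV // mul1r.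
have n0 : phi n != 0 by rewrite phi_n mulf_neq0.
exists (a / n), (- (b / n)); rewrite rmorphN !fmorph_div /=.
apply: (mulIf n2); rewrite mulVf //; apply: (mulfI n0); rewrite mulr1.
rewrite [LHS]phi_n; field; exact: n0.
Qed.

Let spanned_t : spanned t.
Proof. by exists 0, 1; rewrite rmorph0 rmorph1 add0r mul1r. Qed.

Let spanned_iota c : spanned (iota c).
Proof. by exists (iota c), 0; rewrite phi_iota rmorph0 mul0r addr0. Qed.

Let spanned_s : spanned s.
Proof.
rewrite s_t; apply: spannedM.
  by apply: spannedM spanned_t; rewrite -(rmorph_nat iota).
by apply: spannedV; apply: spannedD => //; rewrite -(rmorphN1 iota).
Qed.

Let spanned_horner (p : {poly C}) : spanned (map_poly iota p).[s].
Proof.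
elim/poly_ind: p => [|p c IHp].
  by rewrite rmorph0 horner0 -(rmorph0 iota).
rewrite rmorphD rmorphM /= map_polyX map_polyC hornerMXaddC.
exact: (spannedD (spannedM IHp spanned_s) (spanned_iota c)).
Qed.

Lemma extension_degree_moebius_square : extension_degree phi 2.
Proof.
apply: (extension_degree_sqrt t_notin_phi) => y.
have [p [q [_ ->]]] := s_gen y.
by apply: spannedM; [|apply: spannedV]; apply: spanned_horner.
Qed.

End SquareOfMoebius.

(** * Fractions and subfields *)

Lemma tofrac_div (R : idomainType) (a b c d : R) : b != 0 -> d != 0 ->
  FracField.tofrac a / FracField.tofrac b
    = FracField.tofrac c / FracField.tofrac d <-> a * d = c * b.
Proof.
move=> b0 d0; split=> [|eq_ab].
  move/eqP; rewrite eqr_div ?tofrac_eq0 // -!tofracM tofrac_eq => /eqP -> //.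
by apply/eqP; rewrite eqr_div ?tofrac_eq0 // -!tofracM tofrac_eq eq_ab.
Qed.

Lemma tofrac_divM (R : idomainType) (a b c d : R) :
  FracField.tofrac a / FracField.tofrac b
    * (FracField.tofrac c / FracField.tofrac d)
  = FracField.tofrac (a * c) / FracField.tofrac (b * d).
Proof. by rewrite mulf_div !tofracM. Qed.

Lemma tofrac_divB (R : idomainType) (a b c d : R) : b != 0 -> d != 0 ->
  FracField.tofrac a / FracField.tofrac b
    - FracField.tofrac c / FracField.tofrac d
  = FracField.tofrac (a * d - c * b) / FracField.tofrac (b * d).
Proof.
move=> b0 d0; rewrite -mulNr addf_div ?tofrac_eq0 // mulNr.
by rewrite tofracB !tofracM.
Qed.

Section SubfieldVal.
Variables (F : fieldType) (S : divringClosed F).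
Implicit Types x y : (subfield S : fieldType).

Lemma subfield_valB x y :
  subfield_val (x - y) = subfield_val x - subfield_val y.
Proof. exact: (rmorphB (\val : subfield S -> F)). Qed.

Lemma subfield_valM x y :
  subfield_val (x * y) = subfield_val x * subfield_val y.
Proof. exact: (rmorphM (\val : subfield S -> F)). Qed.

Lemma subfield_val_div x y :
  subfield_val (x / y) = subfield_val x / subfield_val y.
Proof. exact: (fmorph_div (\val : subfield S -> F)). Qed.

Lemma subfield_val_nat n :
  subfield_val (n%:R : (subfield S : fieldType)) = n%:R.
Proof. exact: (rmorph_nat (\val : subfield S -> F)). Qed.

End SubfieldVal.

(** * Multivariate polynomials *)

Lemma rmorph_mmap n (R : nzRingType) (S T : comNzRingType)
    (g : {rmorphism R -> S}) (h : {rmorphism S -> T}) (v : 'I_n -> S)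
    (p : {mpoly R[n]}) :
  h (mmap g v p) = mmap (h \o g) (h \o v) p.
Proof.
rewrite /mmap rmorph_sum; apply: eq_bigr => m _; rewrite rmorphM /=.
by congr (_ * _); rewrite rmorph_prod; apply: eq_bigr => i _; rewrite rmorphXn.
Qed.

Lemma mmap_mpolyX n (R : nzRingType) (p : {mpoly R[n]}) :
  mmap (@mpolyC n R) (fun i => 'X_i) p = p.
Proof.
rewrite [RHS]mpolyE; apply: eq_bigr => m _.
by rewrite mmap1_id mul_mpolyC.
Qed.

Lemma mmap_eq n (R : nzRingType) (S : comNzRingType) (h : R -> S)
    (v w : 'I_n -> S) (p : {mpoly R[n]}) :
  v =1 w -> mmap h v p = mmap h w p.
Proof. by move=> vw; apply: eq_bigr => m _; congr (_ * _); exact: mmap1_eq. Qed.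

Lemma mmap_comp_mpoly n k (R S : comNzRingType) (h : {rmorphism R -> S})
    (v : 'I_n -> S) (lq : k.-tuple {mpoly R[n]}) (p : {mpoly R[k]}) :
  mmap h v (p \mPo lq) = mmap h (fun i => mmap h v (tnth lq i)) p.
Proof.
rewrite comp_mpolyEX [X in _ = mmap _ _ X](mpolyE p) !raddf_sum /=.
apply: eq_bigr => m _; rewrite !mmapZ; congr (_ * _).
rewrite comp_mpolyX rmorph_prod /= mmapX.
by apply: eq_bigr => i _; rewrite rmorphXn.
Qed.

Lemma mmap_dhomog n (R S : comNzRingType) (h : {rmorphism R -> S})
    (v : 'I_n -> S) (p : {mpoly R[n]}) d l :
  p \is d.-homog ->
  mmap h (fun i => l * v i) p = l ^+ d * mmap h v p.
Proof.
move=> hp; rewrite /mmap mulr_sumr; apply: eq_big_seq => m mp.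
rewrite [RHS]mulrCA; congr (_ * _); rewrite /mmap1.
under eq_bigr do rewrite exprMn.
by rewrite big_split prodrXr /= -mdegE (dhomogP _ _ _ hp).
Qed.

Lemma dhomog_prodX n k (R : comNzRingType) (e : nat) (q : 'I_k -> {mpoly R[n]})
    (m : 'I_k -> nat) :
  (forall i, q i \is e.-homog) ->
  \prod_(i < k) q i ^+ m i \is (e * \sum_(i < k) m i)%N.-homog.
Proof.
move=> hq.
apply: (big_rec2 (fun d (p : {mpoly R[n]}) => p \is (e * d)%N.-homog)).
  by rewrite muln0 dhomog1.
move=> i d p _ hp.
by rewrite mulnDr; apply: dhomogM => //; apply: dhomogMn.
Qed.

Lemma comp_mpoly_dhomog n k (R : comNzRingType) (lq : k.-tuple {mpoly R[n]})
    (p : {mpoly R[k]}) d e :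
  p \is d.-homog -> (forall i, tnth lq i \is e.-homog) ->
  p \mPo lq \is (e * d)%N.-homog.
Proof.
move=> hp hq; rewrite comp_mpolyE big_seq; apply: rpred_sum => m mp.
apply: rpredZ; rewrite -(dhomogP _ _ _ hp m mp) /= mdegE.
exact: dhomog_prodX.
Qed.

(** Evaluation in n + 1 variables is evaluation in the first n of them followed
    by evaluation of a univariate polynomial. *)
Lemma mmap_muni n (R S : comNzRingType) (h : {rmorphism R -> S})
    (v : 'I_n.+1 -> S) (p : {mpoly R[n.+1]}) :
  (map_poly (mmap h (fun i => v (widen_ord (leqnSn n) i))) (muni p)).[v ord_max]
  = mmap h v p.
Proof.
rewrite muniE rmorph_sum horner_sum /= [RHS]/mmap.
apply: eq_bigr => m _; rewrite map_polyZ map_polyXn hornerZ hornerXn /=.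
rewrite mmapZ mmapX -mulrA; congr (_ * _).
rewrite /mmap1 big_ord_recr /=; congr (_ * _).
by apply: eq_bigr => i _; rewrite mnmE; congr (v _ ^+ m _); apply: val_inj.
Qed.

Lemma vanishing_poly (F : numFieldType) (p : {poly F}) :
  (forall x, p.[x] = 0) -> p = 0.
Proof.
move=> vp; pose rs := [seq i%:R : F | i <- iota 0 (size p)].
apply: (@roots_geq_poly_eq0 _ p rs); last by rewrite size_map size_iota.
  by apply/allP => x _; apply/rootP.
by rewrite map_inj_uniq ?iota_uniq //; exact: mulrIn (oner_neq0 F).
Qed.

Lemma vanishing_mpoly n (F : numFieldType) (p : {mpoly F[n]}) :
  (forall v, p.@[v] = 0) -> p = 0.
Proof.
elim: n p => [|n IHn] p vp.
  by have := vp (fun=> 0); rewrite [p]nvar0_mpolyC mevalC => ->.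
suff m0 : muni p = 0.
  by rewrite -[p]mmap_mpolyX -(mmap_muni (@mpolyC n.+1 F)) m0 rmorph0 horner0.
apply/polyP => k; rewrite coef0; apply: IHn => v.
have /polyP/(_ k) : map_poly (meval v) (muni p) = 0.
  apply: vanishing_poly => x.
  pose w (i : 'I_n.+1) := if unlift ord_max i is Some j then v j else x.
  rewrite -[RHS](vp w) /meval -mmap_muni /w unlift_none; congr _.[_].
  apply: eq_map_poly => q; apply: mmap_eq => i.
  rewrite (_ : widen_ord _ _ = lift ord_max i) ?liftK //.
  by apply: val_inj; rewrite /= /bump leqNgt ltn_ord.
by rewrite coef0 coef_map.
Qed.

(** * Binary quartics, their invariants and their Hessian *)

Local Notation "''i_' k" := (@Ordinal 5 k isT)
  (at level 8, k at level 2, format "''i_' k").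

Lemma forall_ord5 (P : 'I_5 -> Prop) :
  P 'i_0 -> P 'i_1 -> P 'i_2 -> P 'i_3 -> P 'i_4 -> forall i, P i.
Proof.
by move=> ? ? ? ? ? [[|[|[|[|[|]]]]] //= lt5];
  rewrite (bool_irrelevance lt5 isT).
Qed.

Lemma sum_ord5 (V : nmodType) (F : 'I_5 -> V) :
  \sum_(i < 5) F i = F 'i_0 + F 'i_1 + F 'i_2 + F 'i_3 + F 'i_4.
Proof.
rewrite !big_ord_recl big_ord0 addr0 !addrA.
by congr (_ + _ + _ + _ + _); congr (F _); apply: val_inj.
Qed.

Lemma det_matrix2 (A : comNzRingType) (f : 'I_2 -> 'I_2 -> A) :
  \det (\matrix_(i < 2, j < 2) f i j) = f 0 0 * f 1 1 - f 0 1 * f 1 0.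
Proof.
rewrite (expand_det_row _ ord0) !big_ord_recl big_ord0 addr0.
rewrite /cofactor !det_mx11 !mxE /= expr0 mul1r expr1 mulN1r mulrN.
by congr (f _ _ * f _ _ - f _ _ * f _ _); apply: val_inj.
Qed.

Lemma rmorph_quartic (B0 B : comNzRingType) (h : {rmorphism B0 -> B})
    (a b c d e X Y : B0) :
  h (a * X ^+ 4 + b * (X ^+ 3 * Y) + c * (X ^+ 2 * Y ^+ 2) + d * (X * Y ^+ 3)
     + e * Y ^+ 4) =
  h a * h X ^+ 4 + h b * (h X ^+ 3 * h Y) + h c * (h X ^+ 2 * h Y ^+ 2)
    + h d * (h X * h Y ^+ 3) + h e * h Y ^+ 4.
Proof. by rewrite !(rmorphD, rmorphM, rmorphXn). Qed.

Section Derivations.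
Variables (B : comNzRingType) (D : B -> B).
Hypothesis DD : {morph D : x y / x + y}.
Hypothesis DM : forall x y, D (x * y) = D x * y + x * D y.

Lemma derivation_natM n x : D x = 0 -> D (n%:R * x) = 0.
Proof.
have D0 : D 0 = 0 by apply: (addrI (D 0)); rewrite -DD !addr0.
have Dn y : D y = 0 -> D (y *+ n) = 0.
  by move=> Dy; elim: n => [|k IHk]; rewrite ?mulr0n // mulrS DD Dy IHk addr0.
by rewrite mulr_natl; exact: Dn.
Qed.

Lemma derivation_cubic (a b c d X Y : B) :
  D a = 0 -> D b = 0 -> D c = 0 -> D d = 0 ->
  D (a * X ^+ 3 + b * (X ^+ 2 * Y) + c * (X * Y ^+ 2) + d * Y ^+ 3) =
    (3 * a * X ^+ 2 + 2 * b * X * Y + c * Y ^+ 2) * D X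
    + (b * X ^+ 2 + 2 * c * X * Y + 3 * d * Y ^+ 2) * D Y.
Proof.
move=> Da Db Dc Dd; rewrite !exprS !expr0 !mulr1 !(DD, DM) Da Db Dc Dd; ring.
Qed.

Lemma derivation_quartic (a b c d e X Y : B) :
  D a = 0 -> D b = 0 -> D c = 0 -> D d = 0 -> D e = 0 ->
  D (a * X ^+ 4 + b * (X ^+ 3 * Y) + c * (X ^+ 2 * Y ^+ 2) + d * (X * Y ^+ 3)
     + e * Y ^+ 4) =
    (4 * a * X ^+ 3 + 3 * b * (X ^+ 2 * Y) + 2 * c * (X * Y ^+ 2)
       + d * Y ^+ 3) * D X
    + (b * X ^+ 3 + 2 * c * (X ^+ 2 * Y) + 3 * d * (X * Y ^+ 2)
       + 4 * e * Y ^+ 3) * D Y.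
Proof.
move=> Da Db Dc Dd De; rewrite !exprS !expr0 !mulr1 !(DD, DM) Da Db Dc Dd De.
ring.
Qed.

End Derivations.

(** The Hessian of a quartic for any two derivations behaving as the
    partial derivatives; [D false] and [D true] differentiate in X and in Y. *)
Lemma derivation_hessian (B : comNzRingType) (D : bool -> B -> B)
    (a b c d e X Y : B) (q := a * X ^+ 4 + b * (X ^+ 3 * Y)
       + c * (X ^+ 2 * Y ^+ 2) + d * (X * Y ^+ 3) + e * Y ^+ 4) :
  (forall i, {morph D i : x y / x + y}) ->
  (forall i x y, D i (x * y) = D i x * y + x * D i y) ->
  (forall i, [/\ D i a = 0, D i b = 0, D i c = 0, D i d = 0 & D i e = 0]) ->
  (forall i, D i X = (~~ i)%:R) -> (forall i, D i Y = i%:R) ->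
  D false (D false q) * D true (D true q)
    - D true (D false q) * D false (D true q)
  = (24 * a * c - 9 * b ^+ 2) * X ^+ 4
    + (72 * a * d - 12 * b * c) * (X ^+ 3 * Y)
    + (144 * a * e + 18 * b * d - 12 * c ^+ 2) * (X ^+ 2 * Y ^+ 2)
    + (72 * b * e - 12 * c * d) * (X * Y ^+ 3)
    + (24 * c * e - 9 * d ^+ 2) * Y ^+ 4.
Proof.
move=> DD DM Dcst DX DY.
have Dq i : D i q = if i then
    b * X ^+ 3 + 2 * c * (X ^+ 2 * Y) + 3 * d * (X * Y ^+ 2) + 4 * e * Y ^+ 3
  else
    4 * a * X ^+ 3 + 3 * b * (X ^+ 2 * Y) + 2 * c * (X * Y ^+ 2) + d * Y ^+ 3.
  have [Da Db Dc Dd De] := Dcst i.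
  rewrite /q (derivation_quartic (DD i) (DM i)) // DX DY.
  by case: (i); rewrite /= ?mulr0 ?mulr1 ?add0r ?addr0.
have Dn i n x := derivation_natM (DD i) n (x := x).
have D2 i j : D i (D j q) = if j then
    (3 * b * X ^+ 2 + 2 * (2 * c) * X * Y + 3 * d * Y ^+ 2) * (~~ i)%:R
    + (2 * c * X ^+ 2 + 2 * (3 * d) * X * Y + 3 * (4 * e) * Y ^+ 2) * i%:R
  else
    (3 * (4 * a) * X ^+ 2 + 2 * (3 * b) * X * Y + 2 * c * Y ^+ 2) * (~~ i)%:R
    + (3 * b * X ^+ 2 + 2 * (2 * c) * X * Y + 3 * d * Y ^+ 2) * i%:R.
  have [Da Db Dc Dd De] := Dcst i.
  by rewrite Dq; case: j;
    rewrite (derivation_cubic (DD i) (DM i)) ?Dn // DX DY.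
rewrite !D2 /=; ring.
Qed.

Section QuarticForms.
Variable A : comNzRingType.
Implicit Types (v : 'I_5 -> A) (F : {mpoly A[2]}).

Definition coefs5 (a0 a1 a2 a3 a4 : A) : 'I_5 -> A :=
  fun i => nth 0 [:: a0; a1; a2; a3; a4] i.

Definition qform v : {mpoly A[2]} := \sum_(i < 5) v i *: 'X_[quartic_mnm i].

Lemma qform_homog v : qform v \is 4.-homog.
Proof.
by apply: rpred_sum => i _; apply: rpredZ; rewrite dhomogX /= mdeg_quartic_mnm.
Qed.

Lemma quartic_coord_qform v : quartic_coord (qform v) =1 v.
Proof.
move=> i; rewrite /quartic_coord /qform raddf_sum (bigD1 i) //=.
rewrite mcoeffZ mcoeffX eqxx mulr1 big1 ?addr0 // => j ne.
by rewrite mcoeffZ mcoeffX (inj_eq quartic_mnm_inj) (negPf ne) mulr0.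
Qed.

Lemma qform_quartic_coord F : F \is 4.-homog -> qform (quartic_coord F) = F.
Proof.
move=> hF; rewrite -[RHS](generic_quarticE hF) /generic_quartic raddf_sum.
apply: eq_bigr => i _ /=.
by rewrite map_mpolyZ map_mpolyX /= mevalXU.
Qed.

Lemma qformE v : let X := 'X_0 in let Y := 'X_1 in
  qform v = (v 'i_0)%:MP * X ^+ 4 + (v 'i_1)%:MP * (X ^+ 3 * Y)
    + (v 'i_2)%:MP * (X ^+ 2 * Y ^+ 2) + (v 'i_3)%:MP * (X * Y ^+ 3)
    + (v 'i_4)%:MP * Y ^+ 4.
Proof.
move=> X Y; rewrite /qform sum_ord5 !mul_mpolyC.
have E i : 'X_[quartic_mnm i] = X ^+ (4 - i) * Y ^+ i.
  rewrite mpolyXE_id !big_ord_recl big_ord0 mulr1 !mnmE /=.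
  by congr ('X_ _ ^+ _ * 'X_ _ ^+ _); apply: val_inj.
by rewrite !E /= !expr0 ?mulr1 ?mul1r.
Qed.

(** I2 and I3 are the classical invariants, normalized so that the discriminant
    is proportional to 4 I2^3 - I3^2. *)
Definition I2 v : A :=
  12 * v 'i_0 * v 'i_4 - 3 * v 'i_1 * v 'i_3 + v 'i_2 ^+ 2.

Definition I3 v : A :=
  72 * v 'i_0 * v 'i_2 * v 'i_4 + 9 * v 'i_1 * v 'i_2 * v 'i_3
  - 27 * v 'i_0 * v 'i_3 ^+ 2 - 27 * v 'i_1 ^+ 2 * v 'i_4 - 2 * v 'i_2 ^+ 3.

Definition hess v : 'I_5 -> A :=
  coefs5 (24 * v 'i_0 * v 'i_2 - 9 * v 'i_1 ^+ 2)
       (72 * v 'i_0 * v 'i_3 - 12 * v 'i_1 * v 'i_2)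
       (144 * v 'i_0 * v 'i_4 + 18 * v 'i_1 * v 'i_3 - 12 * v 'i_2 ^+ 2)
       (72 * v 'i_1 * v 'i_4 - 12 * v 'i_2 * v 'i_3)
       (24 * v 'i_2 * v 'i_4 - 9 * v 'i_3 ^+ 2).

(** I2 o He and I3 o He have degrees 4 and 6, hence must be polynomials in I2
    and I3 of these weights; only the constants have to be found. *)
Lemma I2_hess v : I2 (hess v) = 144 * I2 v ^+ 2.
Proof. rewrite /I2 /hess /coefs5 /=; ring. Qed.

Lemma I3_hess v : I3 (hess v) = 1728 * (I3 v ^+ 2 - 2 * I2 v ^+ 3).
Proof. rewrite /I2 /I3 /hess /coefs5 /=; ring. Qed.

(** Coefficients of the quartic after X |-> p X + q Y, Y |-> r X + s Y. *)
Definition subst_coef (p q r s : A) v : 'I_5 -> A :=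
  let a := v 'i_0 in let b := v 'i_1 in let c := v 'i_2 in
  let d := v 'i_3 in let e := v 'i_4 in
  coefs5
    (a * p ^+ 4 + b * (p ^+ 3 * r) + c * (p ^+ 2 * r ^+ 2) + d * (p * r ^+ 3)
       + e * r ^+ 4)
    (a * (4 * p ^+ 3 * q) + b * (p ^+ 3 * s + 3 * p ^+ 2 * q * r)
       + c * (2 * p ^+ 2 * r * s + 2 * p * q * r ^+ 2)
       + d * (3 * p * r ^+ 2 * s + q * r ^+ 3) + e * (4 * r ^+ 3 * s))
    (a * (6 * p ^+ 2 * q ^+ 2) + b * (3 * p ^+ 2 * q * s + 3 * p * q ^+ 2 * r)
       + c * (p ^+ 2 * s ^+ 2 + 4 * p * q * r * s + q ^+ 2 * r ^+ 2)
       + d * (3 * p * r * s ^+ 2 + 3 * q * r ^+ 2 * s)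
       + e * (6 * r ^+ 2 * s ^+ 2))
    (a * (4 * p * q ^+ 3) + b * (3 * p * q ^+ 2 * s + q ^+ 3 * r)
       + c * (2 * p * q * s ^+ 2 + 2 * q ^+ 2 * r * s)
       + d * (p * s ^+ 3 + 3 * q * r * s ^+ 2) + e * (4 * r * s ^+ 3))
    (a * q ^+ 4 + b * (q ^+ 3 * s) + c * (q ^+ 2 * s ^+ 2) + d * (q * s ^+ 3)
       + e * s ^+ 4).

Lemma I2_subst p q r s v :
  I2 (subst_coef p q r s v) = (p * s - q * r) ^+ 4 * I2 v.
Proof. rewrite /I2 /subst_coef /coefs5 /=; ring. Qed.

Lemma I3_subst p q r s v :
  I3 (subst_coef p q r s v) = (p * s - q * r) ^+ 6 * I3 v.
Proof. rewrite /I3 /subst_coef /coefs5 /=; ring. Qed.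

Lemma rmorph_qform (B : comNzRingType) (h : {rmorphism {mpoly A[2]} -> B}) v :
  h (qform v) =
    h (v 'i_0)%:MP * h 'X_0 ^+ 4 + h (v 'i_1)%:MP * (h 'X_0 ^+ 3 * h 'X_1)
    + h (v 'i_2)%:MP * (h 'X_0 ^+ 2 * h 'X_1 ^+ 2)
    + h (v 'i_3)%:MP * (h 'X_0 * h 'X_1 ^+ 3)
    + h (v 'i_4)%:MP * h 'X_1 ^+ 4.
Proof. by rewrite qformE rmorph_quartic. Qed.

Lemma linear_subst_qform (g : 'M[A]_2) v :
  linear_subst g (qform v) =
  qform (subst_coef (g 0 0) (g 1 0) (g 0 1) (g 1 1) v).
Proof.
have X0 : 'X_0 \mPo [tuple \sum_(j < 2) g j i *: 'X_j | i < 2]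
          = (g 0 0)%:MP * 'X_0 + (g 1 0)%:MP * 'X_1 :> {mpoly A[2]}.
  rewrite comp_mpolyXU -tnth_nth tnth_mktuple !big_ord_recl big_ord0 addr0.
  by rewrite !mul_mpolyC; congr (g _ _ *: _ + g _ _ *: 'X_ _); apply: val_inj.
have X1 : 'X_1 \mPo [tuple \sum_(j < 2) g j i *: 'X_j | i < 2]
          = (g 0 1)%:MP * 'X_0 + (g 1 1)%:MP * 'X_1 :> {mpoly A[2]}.
  rewrite comp_mpolyXU -tnth_nth tnth_mktuple !big_ord_recl big_ord0 addr0.
  by rewrite !mul_mpolyC; congr (g _ _ *: _ + g _ _ *: 'X_ _); apply: val_inj.
rewrite /linear_subst rmorph_qform /= X0 X1 !comp_mpolyC qformE.
rewrite /subst_coef /coefs5 /=; ring.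
Qed.

End QuarticForms.

Lemma hessian_qform (A : comNzRingType) (v : 'I_5 -> A) :
  hessian (qform v) = qform (hess v).
Proof.
have U (i j : 'I_2) : 'X_i^`M(j) = (i == j)%:R :> {mpoly A[2]}.
  rewrite mderivX mnm1E; case: eqVneq => [->|_]; last by rewrite scale0r.
  by rewrite scale1r (_ : (U_(j) - U_(j) = 0)%MM) ?mpolyX0 //; apply/mnmP => k;
    rewrite mnmBE mnm0E subnn.
pose D (i : bool) := @mderiv 2 A (if i then 1 else 0).
rewrite /hessian det_matrix2 [qform v]qformE -/(D false) -/(D true).
rewrite derivation_hessian; first 1 last.
- by move=> i p q; exact: mderivD.
- by move=> i p q; exact: mderivM.
- by move=> i; split; exact: mderivC.
- by case; exact: U.
- by case; exact: U.
rewrite qformE /hess /coefs5 /=.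
ring.
Qed.

Lemma rmorph_I2 (A B : comNzRingType) (h : {rmorphism A -> B}) v :
  h (I2 v) = I2 (h \o v).
Proof. by rewrite /I2 !(rmorph_nat, rmorphD, rmorphN, rmorphM, rmorphXn). Qed.

Lemma rmorph_I3 (A B : comNzRingType) (h : {rmorphism A -> B}) v :
  h (I3 v) = I3 (h \o v).
Proof. by rewrite /I3 !(rmorph_nat, rmorphD, rmorphN, rmorphM, rmorphXn). Qed.

Lemma eq_I2 (A : comNzRingType) (v w : 'I_5 -> A) : v =1 w -> I2 v = I2 w.
Proof. by move=> vw; rewrite /I2 !vw. Qed.

Lemma eq_I3 (A : comNzRingType) (v w : 'I_5 -> A) : v =1 w -> I3 v = I3 w.
Proof. by move=> vw; rewrite /I3 !vw. Qed.

Lemma rmorph_hess (A B : comNzRingType) (h : {rmorphism A -> B}) v i :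
  h (hess v i) = hess (h \o v) i.
Proof.
by elim/forall_ord5: i;
  rewrite /hess /coefs5 /= !(rmorph_nat, rmorphD, rmorphN, rmorphM, rmorphXn).
Qed.

Lemma sl2_invariantP (A : comNzRingType) (f : {mpoly A[5]}) :
  sl2_invariant f <->
  forall p q r s v, p * s - q * r = 1 -> f.@[subst_coef p q r s v] = f.@[v].
Proof.
split=> [If p q r s v det1 | If g F det1 hF].
  pose g : 'M_2 := \matrix_(i, j)
    (if i == 0 then if j == 0 then p else r else if j == 0 then q else s).
  have detg : \det g = 1 by rewrite det_matrix2 /= -det1 (mulrC q).
  have := If g (qform v) detg (qform_homog v).
  rewrite linear_subst_qform /eval_quartic.
  by rewrite !(meval_eq _ (quartic_coord_qform _)) !mxE.
rewrite -(qform_quartic_coord hF) linear_subst_qform /eval_quartic.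
rewrite !(meval_eq _ (quartic_coord_qform _)) If //.
rewrite -det1 -[g in \det g]/(g : 'M_2) (_ : g = \matrix_(i, j) g i j).
  by rewrite det_matrix2 !mxE (mulrC (g 1 0)).
by apply/matrixP => i j; rewrite mxE.
Qed.

(** * Invariants are determined by I2 and I3 *)

(** The coefficients of the quartic X^3 Y - a/3 X Y^3 - b/27 Y^4, the one of its
    shape with invariants I2 = a and I3 = b. *)
Definition weierstrass (K : fieldType) (a b : K) : 'I_5 -> K :=
  coefs5 0 1 0 (- 3^-1 * a) (- 27^-1 * b).

Section Weierstrass.
Variable K : fieldType.
Hypothesis three_neq0 : 3 != 0 :> K.

Let n27 : 27 != 0 :> K.
Proof.
have -> : 27 = 3 ^+ 3 :> K by ring.
by rewrite expf_neq0.
Qed.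

Lemma I2_weierstrass (a b : K) : I2 (weierstrass a b) = a.
Proof.
by rewrite /I2 /weierstrass /coefs5 /=; field; rewrite three_neq0 ?n27.
Qed.

Lemma I3_weierstrass (a b : K) : I3 (weierstrass a b) = b.
Proof.
by rewrite /I3 /weierstrass /coefs5 /=; field; rewrite three_neq0 ?n27.
Qed.

Lemma weierstrassE (v : 'I_5 -> K) : v 'i_0 = 0 -> v 'i_1 = 1 -> v 'i_2 = 0 ->
  v =1 weierstrass (I2 v) (I3 v).
Proof.
move=> v0 v1 v2; elim/forall_ord5; rewrite /weierstrass /coefs5 //=;
  by rewrite /I2 /I3 v0 v1 v2; field; rewrite ?three_neq0 ?n27.
Qed.

End Weierstrass.

Section Invariants.
Variable C : numClosedFieldType.
Implicit Types (f g : {mpoly C[5]}) (v : 'I_5 -> C).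

Let C3 : 3 != 0 :> C. Proof. by rewrite pnatr_eq0. Qed.

(** A quartic with a simple root at infinity has X^4-coefficient 0 and
    X^3 Y-coefficient nonzero; an upper triangular substitution makes the latter
    1 and kills the X^2 Y^2-coefficient. *)
Lemma invariant_at_root_infinity f v : sl2_invariant f ->
  v 'i_0 = 0 -> v 'i_1 != 0 -> f.@[v] = f.@[weierstrass (I2 v) (I3 v)].
Proof.
move=> /sl2_invariantP If v0 v1.
(* X |-> r X + q Y, Y |-> r^-1 Y multiplies the X^3 Y-coefficient by r^2 and
   adds 3 r q times it to the X^2 Y^2-coefficient. *)
have r2 : 2.-root (v 'i_1) ^+ 2 = v 'i_1 by exact: sqrtCK.
pose r := (2.-root (v 'i_1))^-1; pose q := - v 'i_2 / (3 * v 'i_1 * r).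
have r0 : r != 0 by rewrite invr_eq0 sqrtC_eq0.
have rv : r ^+ 2 * v 'i_1 = 1 by rewrite /r exprVn r2 mulVf.
have det1 : r * r^-1 - q * 0 = 1 by rewrite mulr0 subr0 mulfV.
rewrite -(If r q 0 r^-1 v det1); set w := subst_coef _ _ _ _ _.
have <- : I2 w = I2 v by rewrite I2_subst det1 expr1n mul1r.
have <- : I3 w = I3 v by rewrite I3_subst det1 expr1n mul1r.
apply: meval_eq; apply: weierstrassE => //;
  rewrite /w /subst_coef /coefs5 /= v0.
- ring.
- by rewrite -rv; field.
- by rewrite /q; field; rewrite v1 r0.
Qed.

(** When the discriminant does not vanish, any root can be sent to infinity, and
    it is a simple one. *)
Lemma invariant_at_separable f v : sl2_invariant f ->
  4 * I2 v ^+ 3 != I3 v ^+ 2 -> f.@[v] = f.@[weierstrass (I2 v) (I3 v)].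
Proof.
move=> If D0.
(* A double root at infinity would give I2 = c^2 and I3 = - 2 c^3. *)
have D1 w : I2 w = I2 v -> I3 w = I3 v -> w 'i_0 = 0 -> w 'i_1 != 0.
  move=> e2 e3 w0; apply: contra_neq D0 => w1; rewrite -e2 -e3 /I2 /I3 w0 w1.
  ring.
have [v0|v0] := eqVneq (v 'i_0) 0.
  by apply: invariant_at_root_infinity => //; apply: D1.
pose p : {poly C} :=
  \poly_(i < 5) nth 0 [:: v 'i_4; v 'i_3; v 'i_2; v 'i_1; v 'i_0] i.
have [|z /rootP pz] := closed_rootP p _.
  by rewrite size_poly_eq.
(* X |-> z X - Y, Y |-> X makes F (z, 1) the new X^4-coefficient. *)
have det1 : z * 0 - (-1) * 1 = 1 :> C by ring.
move/sl2_invariantP/(_ z (-1) 1 0 v det1) : (If) => <-.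
set w := subst_coef _ _ _ _ _.
have e2 : I2 w = I2 v by rewrite I2_subst det1 expr1n mul1r.
have e3 : I3 w = I3 v by rewrite I3_subst det1 expr1n mul1r.
have w0 : w 'i_0 = 0.
  rewrite -pz horner_poly sum_ord5 /w /subst_coef /coefs5 /=; ring.
by rewrite -e2 -e3; apply: invariant_at_root_infinity => //; apply: D1.
Qed.

Let X : 'I_5 -> {mpoly C[5]} := fun i => 'X_i.

Lemma meval_I2 v : (I2 X).@[v] = I2 v.
Proof. by rewrite rmorph_I2; apply: eq_I2 => i; rewrite /= mevalXU. Qed.

Lemma meval_I3 v : (I3 X).@[v] = I3 v.
Proof. by rewrite rmorph_I3; apply: eq_I3 => i; rewrite /= mevalXU. Qed.

(** The Weierstrass quartic with the invariants of the generic quartic. *)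
Definition weierstrass_tuple : 5.-tuple {mpoly C[5]} :=
  [tuple coefs5 0 1 0 ((- 3^-1)%:MP * I2 X) ((- 27^-1)%:MP * I3 X) i | i < 5].

Lemma mmap_weierstrass_tuple (K : fieldType) (h : {rmorphism C -> K})
    (v : 'I_5 -> K) i :
  mmap h v (tnth weierstrass_tuple i) = weierstrass (I2 v) (I3 v) i.
Proof.
have e2 : mmap h v (I2 X) = I2 v.
  by rewrite rmorph_I2; apply: eq_I2 => j; rewrite /= mmapX mmap1U.
have e3 : mmap h v (I3 X) = I3 v.
  by rewrite rmorph_I3; apply: eq_I3 => j; rewrite /= mmapX mmap1U.
have hV n : h (- n%:R^-1) = - n%:R^-1 by rewrite rmorphN fmorphV rmorph_nat.
rewrite tnth_mktuple; elim/forall_ord5: i; rewrite /weierstrass /coefs5 /=.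
- exact: rmorph0.
- exact: rmorph1.
- exact: rmorph0.
- by rewrite rmorphM /= mmapC e2; congr (_ * _); exact: hV.
- by rewrite rmorphM /= mmapC e3; congr (_ * _); exact: hV.
Qed.

(** The two polynomials agree wherever the discriminant is nonzero, hence
    everywhere, the ring of polynomials being a domain. *)
Lemma invariant_weierstrass_tuple f :
  sl2_invariant f -> f \mPo weierstrass_tuple = f.
Proof.
move=> If; apply/eqP; rewrite eq_sym -subr_eq0.
have : (f - (f \mPo weierstrass_tuple)) * (4 * I2 X ^+ 3 - I3 X ^+ 2) == 0.
  apply/eqP/vanishing_mpoly => v.
  rewrite mevalM !mevalB mevalM !rmorphXn /= rmorph_nat meval_I2 meval_I3.
  have [->|D0] := eqVneq (4 * I2 v ^+ 3) (I3 v ^+ 2).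
    by rewrite subrr mulr0.
  rewrite comp_mpoly_meval (invariant_at_separable If D0).
  rewrite [X in _ - X](meval_eq _ (mmap_weierstrass_tuple idfun v)).
  by rewrite subrr mul0r.
rewrite mulf_eq0 => /orP[//|/eqP /(congr1 (meval (weierstrass 1 0)))].
rewrite mevalB mevalM !rmorphXn /= rmorph_nat meval_I2 meval_I3 meval0.
rewrite I2_weierstrass // I3_weierstrass // expr1n mulr1 expr0n subr0 => /eqP.
by rewrite pnatr_eq0.
Qed.

Lemma mmap_invariant (K : fieldType) (h : {rmorphism C -> K}) f
    (v : 'I_5 -> K) : sl2_invariant f ->
  mmap h v f = mmap h (weierstrass (I2 v) (I3 v)) f.
Proof.
move=> If; rewrite -{1}(invariant_weierstrass_tuple If) mmap_comp_mpoly.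
exact/mmap_eq/mmap_weierstrass_tuple.
Qed.

Lemma meval_invariant f v : sl2_invariant f ->
  f.@[v] = f.@[weierstrass (I2 v) (I3 v)].
Proof. exact: (mmap_invariant idfun). Qed.

(** Multiplying a quartic by l multiplies I2 by l^2 and I3 by l^3. *)
Lemma mmap_weierstrass_homog (K : fieldType) (h : {rmorphism C -> K}) f d
    (l a b : K) : sl2_invariant f -> f \is d.-homog ->
  mmap h (weierstrass (l ^+ 2 * a) (l ^+ 3 * b)) f
    = l ^+ d * mmap h (weierstrass a b) f.
Proof.
move=> If hf; rewrite -mmap_dhomog // [RHS]mmap_invariant //.
have K3 : 3 != 0 :> K by rewrite -(rmorph_nat h) fmorph_eq0.
have I2l (v : 'I_5 -> K) : I2 (fun i => l * v i) = l ^+ 2 * I2 v.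
  by rewrite /I2; ring.
have I3l (v : 'I_5 -> K) : I3 (fun i => l * v i) = l ^+ 3 * I3 v.
  by rewrite /I3; ring.
by rewrite I2l I3l I2_weierstrass // I3_weierstrass.
Qed.

(** * The pullback of invariants along the Hessian *)

Lemma hessian_pullback_comp f :
  hessian_pullback f = f \mPo [tuple hess X i | i < 5].
Proof.
congr (_ \mPo _); apply: eq_from_tnth => i; rewrite !tnth_mktuple.
by rewrite -[generic_quartic C]/(qform X) hessian_qform quartic_coord_qform.
Qed.

Lemma meval_hessian_pullback f v : (hessian_pullback f).@[v] = f.@[hess v].
Proof.
rewrite hessian_pullback_comp comp_mpoly_meval; apply: meval_eq => i.
rewrite tnth_mktuple rmorph_hess.
by elim/forall_ord5: i; rewrite /hess /coefs5 /= !mevalXU.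
Qed.

Lemma hessian_pullback_I2 : hessian_pullback (I2 X) = 144 * I2 X ^+ 2.
Proof.
rewrite hessian_pullback_comp rmorph_I2 -I2_hess; apply: eq_I2 => i.
by rewrite /= comp_mpolyXU -tnth_nth tnth_mktuple.
Qed.

Lemma hessian_pullback_I3 :
  hessian_pullback (I3 X) = 1728 * (I3 X ^+ 2 - 2 * I2 X ^+ 3).
Proof.
rewrite hessian_pullback_comp rmorph_I3 -I3_hess; apply: eq_I3 => i.
by rewrite /= comp_mpolyXU -tnth_nth tnth_mktuple.
Qed.

Lemma hessian_pullback_homog f d :
  f \is d.-homog -> hessian_pullback f \is (2 * d)%N.-homog.
Proof.
move=> hf; rewrite hessian_pullback_comp; apply: comp_mpoly_dhomog => // i.
have hX j : X j \is 1.-homog by rewrite dhomogX /= mdeg1.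
have hM (n : nat) j k : n%:R * X j * X k \is 2.-homog.
  by rewrite -mulrA mulr_natl rpredMn //; apply: (@dhomogM _ _ _ 1 _ 1).
have hS (n : nat) j : n%:R * X j ^+ 2 \is 2.-homog by rewrite expr2 mulrA hM.
by rewrite tnth_mktuple; elim/forall_ord5: i;
  rewrite /hess /coefs5 /= ?(rpredB, rpredD).
Qed.

(** An invariant f depends only on I2 and I3, and the invariants of He F depend
    only on those of F. *)
Lemma hessian_pullback_invariant f :
  sl2_invariant f -> sl2_invariant (hessian_pullback f).
Proof.
move=> If; apply/sl2_invariantP => p q r s v det1.
rewrite !meval_hessian_pullback (meval_invariant _ If).
rewrite [RHS](meval_invariant _ If).
by rewrite !I2_hess !I3_hess I2_subst I3_subst det1 !expr1n !mul1r.
Qed.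

(** Dominance of the self-map: any values of I2 and I3 are those of the Hessian
    of some Weierstrass quartic, by extracting two square roots. *)
Lemma hessian_pullback_eq0 f :
  sl2_invariant f -> hessian_pullback f = 0 -> f = 0.
Proof.
move=> If Hf0; apply: vanishing_mpoly => v; rewrite (meval_invariant _ If).
pose a := 2.-root (I2 v / 144).
pose b := 2.-root (I3 v / 1728 + 2 * a ^+ 3).
have <- : I2 (hess (weierstrass a b)) = I2 v.
  rewrite I2_hess I2_weierstrass // sqrtCK mulrC divfK //.
  by rewrite pnatr_eq0.
have <- : I3 (hess (weierstrass a b)) = I3 v.
  rewrite I3_hess I2_weierstrass // I3_weierstrass // sqrtCK addrK.
  by rewrite mulrC divfK // pnatr_eq0.
by rewrite -(meval_invariant _ If) -meval_hessian_pullback Hf0 meval0.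
Qed.

End Invariants.

(** * The function field *)

(** Rescaling by l = 2 a / b moves the invariants (a, b) to (j, 2 j), with
    j = 4 a^3 / b^2. *)
Lemma weierstrass_scaling (K : fieldType) (a b : K) :
  2 != 0 :> K -> a != 0 -> b != 0 ->
  exists l, [/\ l != 0, l ^+ 2 * a = 4 * a ^+ 3 / b ^+ 2
             & l ^+ 3 * b = 2 * (4 * a ^+ 3 / b ^+ 2)].
Proof.
move=> two a0 b0; exists (2 * a / b); split; last 2 first.
- by field.
- by field.
by rewrite !mulf_neq0 ?invr_eq0.
Qed.

Lemma divf_common_factor (K : fieldType) (l u w : K) :
  l != 0 -> w != 0 -> l * w != 0 /\ u / w = l * u / (l * w).
Proof. by move=> l0 w0; split; [rewrite mulf_neq0 | field; rewrite l0 w0]. Qed.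

Lemma rmorph_hessian_num (A B : comNzRingType) (h : {rmorphism A -> B})
    (u : A) :
  h (4 * (144 * u ^+ 2) ^+ 3) = 4 * (144 * h u ^+ 2) ^+ 3.
Proof. by rewrite !(rmorph_nat, rmorphM, rmorphXn). Qed.

Lemma rmorph_hessian_den (A B : comNzRingType) (h : {rmorphism A -> B})
    (u w : A) :
  h ((1728 * (w ^+ 2 - 2 * u ^+ 3)) ^+ 2)
    = (1728 * (h w ^+ 2 - 2 * h u ^+ 3)) ^+ 2.
Proof. by rewrite !(rmorph_nat, rmorphB, rmorphM, rmorphXn). Qed.

(** The constants cancel because 144^3 = 1728^2, which is what makes the image
    of j an exact square. *)
Lemma hessian_moebius (K : fieldType) (u w : K) (j := 4 * u ^+ 3 / w ^+ 2) :
  2 != 0 :> K -> 3 != 0 :> K -> w != 0 -> j - 2 != 0 ->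
  4 * (144 * u ^+ 2) ^+ 3 / (1728 * (w ^+ 2 - 2 * u ^+ 3)) ^+ 2
    = j / (j - 2) * (j / (j - 2)).
Proof.
move=> two three w0 j2.
have jE : j - 2 = - 2 * (w ^+ 2 - 2 * u ^+ 3) / w ^+ 2.
  by rewrite /j; field.
have d0 : w ^+ 2 - 2 * u ^+ 3 != 0.
  by apply: contra_neq j2 => d0; rewrite jE d0 mulr0 mul0r.
have n1728 : 1728 != 0 :> K.
  have -> : 1728 = 2 ^+ 6 * 3 ^+ 3 :> K by ring.
  by rewrite mulf_neq0 ?expf_neq0.
by rewrite jE /j; field; rewrite w0 d0 n1728 oppr_eq0 two.
Qed.

Section FunctionField.
Variable C : numClosedFieldType.
Implicit Types (f g : {mpoly C[5]}).

Let X : 'I_5 -> {mpoly C[5]} := fun i => 'X_i.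
Local Notation frac := (@FracField.tofrac {mpoly C[5]}).
Local Notation L := (El2_field C).
Let iota : {rmorphism C -> {fraction {mpoly C[5]}}} := frac \o @mpolyC 5 C.

Lemma sl2_invariantM f g :
  sl2_invariant f -> sl2_invariant g -> sl2_invariant (f * g).
Proof.
move=> If Ig h F dh hF; rewrite /eval_quartic !mevalM.
by congr (_ * _); [exact: If|exact: Ig].
Qed.

Lemma sl2_invariantB f g :
  sl2_invariant f -> sl2_invariant g -> sl2_invariant (f - g).
Proof.
move=> If Ig h F dh hF; rewrite /eval_quartic !mevalB.
by congr (_ - _); [exact: If|exact: Ig].
Qed.

Lemma sl2_invariantC (c : C) : sl2_invariant c%:MP.
Proof. by move=> h F _ _; rewrite /eval_quartic !mevalC. Qed.

Lemma sl2_invariant_I2 : sl2_invariant (I2 X).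
Proof.
apply/sl2_invariantP => p q r s v det1.
by rewrite !meval_I2 I2_subst det1 expr1n mul1r.
Qed.

Lemma sl2_invariant_I3 : sl2_invariant (I3 X).
Proof.
apply/sl2_invariantP => p q r s v det1.
by rewrite !meval_I3 I3_subst det1 expr1n mul1r.
Qed.

Lemma I2_homog : I2 X \is 2.-homog.
Proof.
have hX j : X j \is 1.-homog by rewrite dhomogX /= mdeg1.
have hM (n : nat) j k : n%:R * X j * X k \is 2.-homog.
  by rewrite -mulrA mulr_natl rpredMn //; apply: (@dhomogM _ _ _ 1 _ 1).
by rewrite rpredD ?rpredB //; apply: (dhomogMn 2 (hX _)).
Qed.

Lemma I3_homog : I3 X \is 3.-homog.
Proof.
have hX j : X j \is 1.-homog by rewrite dhomogX /= mdeg1.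
have hM (n : nat) i j k : n%:R * X i * X j * X k \is 3.-homog.
  rewrite -!mulrA mulr_natl rpredMn //; apply: (@dhomogM _ _ _ 1 _ 2) => //.
  exact: (@dhomogM _ _ _ 1 _ 1).
have hM2 (n : nat) i j : n%:R * X i * X j ^+ 2 \is 3.-homog.
  by rewrite expr2 mulrA.
have hM3 (n : nat) i j : n%:R * X i ^+ 2 * X j \is 3.-homog.
  by rewrite expr2 mulrA.
have hM4 (n : nat) i : n%:R * X i ^+ 3 \is 3.-homog.
  by rewrite exprS expr2 !mulrA.
by rewrite /I3 !(rpredB, rpredD).
Qed.

Lemma I3_neq0 : I3 X != 0.
Proof.
apply/eqP => /(congr1 (meval (weierstrass 0 1))).
rewrite meval_I3 meval0 I3_weierstrass.
  by move/eqP; rewrite oner_eq0.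
by rewrite pnatr_eq0.
Qed.

Lemma I2_neq0 : I2 X != 0.
Proof.
apply/eqP => /(congr1 (meval (weierstrass 1 0))).
rewrite meval_I2 meval0 I2_weierstrass.
  by move/eqP; rewrite oner_eq0.
by rewrite pnatr_eq0.
Qed.

Lemma El2_fraction_const c : El2_fraction (iota c) c%:MP 1.
Proof.
split; [|exact: sl2_invariantC|exact: (@sl2_invariantC 1)|exact: oner_neq0|].
  exists 0%N; split; last exact: dhomog1.
  by rewrite -[c%:MP]mulr1 mul_mpolyC rpredZ // dhomog1.
by rewrite rmorph1 divr1.
Qed.

Lemma El2_fractionM x y f g f' g' : El2_fraction x f g ->
  El2_fraction y f' g' -> El2_fraction (x * y) (f * f') (g * g').
Proof.
move=> [[d [hf hg]] If Ig g0 ->] [[d' [hf' hg']] If' Ig' g'0 ->].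
split; last by rewrite tofrac_divM.
- by exists (d + d')%N; split; exact: dhomogM.
- exact: sl2_invariantM.
- exact: sl2_invariantM.
- exact: mulf_neq0.
Qed.

Lemma El2_fractionB x y f g f' g' : El2_fraction x f g ->
  El2_fraction y f' g' -> El2_fraction (x - y) (f * g' - f' * g) (g * g').
Proof.
move=> [[d [hf hg]] If Ig g0 ->] [[d' [hf' hg']] If' Ig' g'0 ->].
split; last by rewrite tofrac_divB.
- exists (d + d')%N; split; last exact: dhomogM.
  by apply: rpredB; last rewrite addnC; exact: dhomogM.
- by apply: sl2_invariantB; exact: sl2_invariantM.
- exact: sl2_invariantM.
- exact: mulf_neq0.
Qed.

(** The normalization puts the discriminant 4 I2^3 = I3^2 at j = 1 and makes the
    Hessian act by (j / (j - 2))^2. *)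
Definition j_frac : {fraction {mpoly C[5]}} :=
  frac (4 * I2 X ^+ 3) / frac (I3 X ^+ 2).

Lemma El2_fraction_j : El2_fraction j_frac (4 * I2 X ^+ 3) (I3 X ^+ 2).
Proof.
split=> //.
- exists 6%N; split; last exact: (dhomogMn 2 I3_homog).
  by rewrite mulr_natl rpredMn //; exact: (dhomogMn 3 I2_homog).
- rewrite -(rmorph_nat (@mpolyC 5 C)) !exprS expr0 mulr1.
  by do ![apply: sl2_invariantM | exact: sl2_invariant_I2
         | exact: sl2_invariantC].
- by apply: sl2_invariantM; exact: sl2_invariant_I3.
- by rewrite expf_neq0 // I3_neq0.
Qed.

Lemma El2_fraction_mem x f g : El2_fraction x f g -> x \in @El2_rational C.
Proof. by move=> h; apply/asboolP; exists f, g. Qed.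

Definition El2_of x f g (h : El2_fraction x f g) : L :=
  Subfield (El2_fraction_mem h).

Definition El2_const (c : C) : L := El2_of (El2_fraction_const c).
Definition El2_j : L := El2_of El2_fraction_j.

Lemma El2_val_inj : injective (@subfield_val _ (@El2_rational C)).
Proof. exact: val_inj. Qed.

Lemma El2_valB (x y : L) :
  subfield_val (x - y) = subfield_val x - subfield_val y.
Proof. exact: subfield_valB. Qed.

Lemma El2_valM (x y : L) :
  subfield_val (x * y) = subfield_val x * subfield_val y.
Proof. exact: subfield_valM. Qed.

Lemma El2_val_div (x y : L) :
  subfield_val (x / y) = subfield_val x / subfield_val y.
Proof. exact: subfield_val_div. Qed.

Lemma El2_val_nat n :
  subfield_val (n%:R : L) = n%:R.
Proof. exact: subfield_val_nat. Qed.

Fact El2_const_zmod : zmod_morphism El2_const.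
Proof. move=> c d; apply: val_inj; rewrite rmorphB; exact: (rmorphB iota). Qed.
Fact El2_const_monoid : monoid_morphism El2_const.
Proof.
by split=> [|c d]; apply: val_inj; rewrite ?rmorph1 ?[RHS]rmorphM;
  [exact: (rmorph1 iota)|exact: (rmorphM iota)].
Qed.

HB.instance Definition _ :=
  GRing.isZmodMorphism.Build C (El2_field C) El2_const El2_const_zmod.
HB.instance Definition _ :=
  GRing.isMonoidMorphism.Build C (El2_field C) El2_const El2_const_monoid.

(** I2^3 and I3^2 are not proportional: on the quartic with I2 = 1 and I3 = 0
    only one of them vanishes. *)
Lemma El2_j_notin c : El2_j != El2_const c.
Proof.
apply/eqP => /(congr1 (@subfield_val _ _)) /=; rewrite /j_frac.
have n0 : frac (I3 X ^+ 2) != 0 by rewrite tofrac_eq0 expf_neq0 // I3_neq0.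
move/(canRL (divfK n0)); rewrite -rmorphM => /eqP; rewrite tofrac_eq => /eqP.
move/(congr1 (meval (weierstrass 1 0))).
rewrite mevalM [RHS]mevalM !rmorphXn /= rmorph_nat meval_I2 meval_I3.
rewrite I2_weierstrass ?I3_weierstrass ?pnatr_eq0 //.
by rewrite expr1n mulr1 expr0n mulr0 => /eqP; rewrite pnatr_eq0.
Qed.

(** f restricted to the curve of Weierstrass quartics with invariants
    (u, 2 u), which meets the class of a general quartic where u is its j. *)
Definition weierstrass_poly f : {poly C} :=
  mmap (@polyC C) (coefs5 0 1 0 ((- 3^-1)%:P * 'X) ((- 27^-1)%:P * (2 * 'X))) f.

Lemma horner_weierstrass_poly (K : fieldType) (h : {rmorphism C -> K})
    (x : K) f :
  (map_poly h (weierstrass_poly f)).[x] = mmap h (weierstrass x (2 * x)) f.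
Proof.
pose e : {rmorphism {poly K} -> K} := horner_eval x.
rewrite -[LHS]/((e \o map_poly h) _) rmorph_mmap.
have hV n : h (- n%:R^-1) = - n%:R^-1 by rewrite rmorphN fmorphV rmorph_nat.
rewrite [LHS](_ : _ = mmap h ((e \o map_poly h) \o
    coefs5 0 1 0 ((- 3^-1)%:P * 'X) ((- 27^-1)%:P * (2 * 'X))) f); last first.
  by apply: eq_bigr => m _; rewrite /e /= map_polyC /= /horner_eval hornerC.
apply: mmap_eq; elim/forall_ord5; rewrite /weierstrass /coefs5 /=.
- by rewrite !rmorph0.
- by rewrite !rmorph1.
- by rewrite !rmorph0.
- rewrite rmorphM /= map_polyC map_polyX rmorphM /= /horner_eval.
  by rewrite hornerC hornerX /= hV.
- rewrite !rmorphM /= map_polyC map_polyX !rmorph_nat /= /horner_eval.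
  by rewrite hornerC hornerX /= hV.
Qed.

Lemma j_fracE : j_frac = 4 * frac (I2 X) ^+ 3 / frac (I3 X) ^+ 2.
Proof. by rewrite /j_frac rmorphM !rmorphXn rmorph_nat. Qed.

(** Over the function field of the space of quartics, rescaling the generic
    quartic by l = 2 I2 / I3 multiplies f and g by the same factor l^d and
    moves their common Weierstrass quartic to the curve (u, 2 u), at u = j. *)
Lemma El2_fraction_horner x f g : El2_fraction x f g ->
  (map_poly iota (weierstrass_poly g)).[j_frac] != 0 /\
  x = (map_poly iota (weierstrass_poly f)).[j_frac]
      / (map_poly iota (weierstrass_poly g)).[j_frac].
Proof.
case=> [[d [hf hg]] If Ig g0 ->].
have i2 : frac (I2 X) != 0 by rewrite tofrac_eq0 I2_neq0.
have i3 : frac (I3 X) != 0 by rewrite tofrac_eq0 I3_neq0.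
have two : 2 != 0 :> {fraction {mpoly C[5]}}.
  by rewrite -(rmorph_nat iota) fmorph_eq0 pnatr_eq0.
have [l [l0 l2 l3]] := weierstrass_scaling two i2 i3.
have E p : sl2_invariant p -> p \is d.-homog ->
    (map_poly iota (weierstrass_poly p)).[j_frac] = l ^+ d * frac p.
  move=> Ip hp; rewrite horner_weierstrass_poly j_fracE -l3 -l2.
  rewrite (mmap_weierstrass_homog _ _ _ _ Ip hp); congr (_ * _).
  rewrite -[p in RHS]mmap_mpolyX rmorph_mmap [RHS](mmap_invariant _ _ Ip).
  by rewrite rmorph_I2 rmorph_I3.
have g0' : frac g != 0 by rewrite tofrac_eq0.
rewrite (E f If hf) (E g Ig hg).
exact: divf_common_factor (expf_neq0 d l0) g0'.
Qed.

Lemma val_horner_El2 (p : {poly C}) :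
  subfield_val (map_poly El2_const p).[El2_j] = (map_poly iota p).[j_frac].
Proof.
pose v : {rmorphism L -> {fraction {mpoly C[5]}}} := val.
rewrite -[LHS]/(v _) -horner_map; congr (_.[_]).
rewrite -[LHS](map_poly_comp v El2_const).
exact: eq_map_poly.
Qed.

Lemma El2_gen (y : L) : exists p q : {poly C},
  (map_poly El2_const q).[El2_j] != 0 /\
  y = (map_poly El2_const p).[El2_j] / (map_poly El2_const q).[El2_j].
Proof.
case: y => y Hy; have /asboolP [f [g h]] := Hy.
have [nz eq_y] := El2_fraction_horner h.
exists (weierstrass_poly f), (weierstrass_poly g); split.
  by rewrite -(inj_eq val_inj) /= val_horner_El2.
by apply: val_inj; rewrite /= !val_horner_El2 -eq_y.
Qed.

(** * The comorphism of the Hessian self-map *)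

Lemma hessian_pullbackM f g :
  hessian_pullback (f * g) = hessian_pullback f * hessian_pullback g.
Proof. exact: rmorphM. Qed.

Lemma hessian_pullbackB f g :
  hessian_pullback (f - g) = hessian_pullback f - hessian_pullback g.
Proof. exact: rmorphB. Qed.

Lemma El2_fraction_hessian x f g : El2_fraction x f g ->
  El2_fraction (frac (hessian_pullback f) / frac (hessian_pullback g))
    (hessian_pullback f) (hessian_pullback g).
Proof.
case=> [[d [hf hg]] If Ig g0 _]; split=> //.
- by exists (2 * d)%N; split; apply: hessian_pullback_homog.
- exact: hessian_pullback_invariant.
- exact: hessian_pullback_invariant.
- by apply: contra_neq g0; apply: hessian_pullback_eq0.
Qed.

Lemma subfield_valP (x : L) : exists f g, El2_fraction (subfield_val x) f g.
Proof. by case: x => x /= /asboolP. Qed.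

Lemma El2_hessian_subproof (x : L) :
  {fg : {mpoly C[5]} * {mpoly C[5]} | El2_fraction (subfield_val x) fg.1 fg.2}.
Proof.
by apply: cid; have [f [g h]] := subfield_valP x; exists (f, g).
Qed.

(** The comorphism is computed on a chosen fraction f / g; by [El2_hessianE] the
    choice does not matter. *)
Definition El2_hessian (x : L) : L :=
  El2_of (El2_fraction_hessian (svalP (El2_hessian_subproof x))).

(** Pulling back is a ring morphism that kills no nonzero invariant, so it
    preserves the equality f g' = f' g of two fractions. *)
Lemma El2_hessianE x f g : El2_fraction (subfield_val x) f g ->
  subfield_val (El2_hessian x) =
    frac (hessian_pullback f) / frac (hessian_pullback g).
Proof.
move=> h; rewrite /El2_hessian /=.
case: (El2_hessian_subproof x) => [[f' g'] /= h'].
have [_ _ _ nz _] := El2_fraction_hessian h.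
have [_ _ _ nz' _] := El2_fraction_hessian h'.
case: h h' => _ _ _ g0 -> [_ _ _ g'0 eq_fg].
apply/(tofrac_div _ _ nz' nz); rewrite -!hessian_pullbackM.
by congr hessian_pullback; apply/(tofrac_div _ _ g'0 g0).
Qed.

Fact El2_hessian_zmod : zmod_morphism El2_hessian.
Proof.
move=> x y; have [f [g h]] := subfield_valP x.
have [f' [g' h']] := subfield_valP y.
have [_ _ _ nz _] := El2_fraction_hessian h.
have [_ _ _ nz' _] := El2_fraction_hessian h'.
have hB : El2_fraction (subfield_val (x - y)) (f * g' - f' * g) (g * g').
  by rewrite El2_valB; exact: El2_fractionB.
apply: El2_val_inj; rewrite El2_valB.
rewrite (El2_hessianE hB) (El2_hessianE h) (El2_hessianE h').
by rewrite hessian_pullbackB !hessian_pullbackM tofrac_divB.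
Qed.

Fact El2_hessian_monoid : monoid_morphism El2_hessian.
Proof.
split=> [|x y].
  have h1 : El2_fraction (subfield_val (1 : L)) 1 1.
    by have := El2_fraction_const 1; rewrite !rmorph1.
  apply: El2_val_inj; rewrite (El2_hessianE h1).
  by rewrite [hessian_pullback 1]rmorph1 tofrac1 divr1.
have [f [g h]] := subfield_valP x; have [f' [g' h']] := subfield_valP y.
have hM : El2_fraction (subfield_val (x * y)) (f * f') (g * g').
  by rewrite El2_valM; exact: El2_fractionM.
apply: El2_val_inj; rewrite El2_valM.
rewrite (El2_hessianE hM) (El2_hessianE h) (El2_hessianE h').
by rewrite !hessian_pullbackM tofrac_divM.
Qed.

HB.instance Definition _ :=
  GRing.isZmodMorphism.Build (El2_field C) (El2_field C) El2_hessian
    El2_hessian_zmod.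
HB.instance Definition _ :=
  GRing.isMonoidMorphism.Build (El2_field C) (El2_field C) El2_hessian
    El2_hessian_monoid.

Lemma El2_hessian_const c : El2_hessian (El2_const c) = El2_const c.
Proof.
apply: El2_val_inj.
rewrite (@El2_hessianE (El2_const c) _ _ (El2_fraction_const c)).
by rewrite /hessian_pullback comp_mpolyC rmorph1 rmorph1 divr1.
Qed.

Lemma El2_hessian_j : El2_hessian El2_j = (El2_j / (El2_j - 2)) ^+ 2.
Proof.
have i3 : frac (I3 X) != 0 by rewrite tofrac_eq0 I3_neq0.
have n0 n : n.+1%:R != 0 :> {fraction {mpoly C[5]}}.
  by rewrite -(rmorph_nat iota) fmorph_eq0 pnatr_eq0.
have j2 : j_frac - 2 != 0.
  apply: contraNneq (El2_j_notin 2) => /eqP; rewrite subr_eq0 => /eqP e.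
  by apply/eqP/El2_val_inj; rewrite [LHS]e -[RHS]/(iota 2) rmorph_nat.
apply: El2_val_inj; rewrite (@El2_hessianE El2_j _ _ El2_fraction_j).
rewrite expr2 El2_valM El2_val_div El2_valB El2_val_nat [subfield_val El2_j]/=.
have -> : hessian_pullback (4 * I2 X ^+ 3) = 4 * (144 * I2 X ^+ 2) ^+ 3.
  by rewrite -hessian_pullback_I2 /hessian_pullback rmorphM rmorph_nat rmorphXn.
have -> : hessian_pullback (I3 X ^+ 2) =
    (1728 * (I3 X ^+ 2 - 2 * I2 X ^+ 3)) ^+ 2.
  by rewrite -hessian_pullback_I3 /hessian_pullback rmorphXn.
move: j2; rewrite j_fracE => j2.
rewrite (rmorph_hessian_num (@FracField.tofrac {mpoly C[5]})).
rewrite (rmorph_hessian_den (@FracField.tofrac {mpoly C[5]})).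
exact: hessian_moebius (n0 1%N) (n0 2%N) i3 j2.
Qed.

Lemma El2_hessian_comorphism : hessian_comorphism El2_hessian.
Proof.
move=> x f g h; split; last exact: El2_hessianE.
by have [] := El2_fraction_hessian h.
Qed.

Lemma El2_hessian_degree : extension_degree El2_hessian 2.
Proof.
apply: (extension_degree_moebius_square (iota := El2_const) (s := El2_j)).
- by rewrite -(rmorph_nat El2_const) fmorph_eq0 pnatr_eq0.
- exact: El2_hessian_const.
- exact: El2_j_notin.
- exact: El2_gen.
- exact: El2_hessian_j.
Qed.

End FunctionField.

Theorem theorem2 (R : realType) :
  exists phi : {rmorphism El2_field R[i]%C -> El2_field R[i]%C},
    hessian_comorphism phi /\ extension_degree phi 2.
Proof.
exists (@El2_hessian R[i]%C : {rmorphism _ -> _}); split.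
  exact: El2_hessian_comorphism.
exact: El2_hessian_degree.
Qed.
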